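(* Let $I=[0,1]$ or $I=[0,\infty)$. Let $A_0$ be a Banach r.i. space on $I$ and let $A_1$ be a quasi-Banach r.i. space on $I$. Suppose that there is a constant $C$ with $C^{-1}\phi_{A_1}\le \phi_{A_0}\le C\phi_{A_1}$, and that $\frac{1}{\phi_{A_1}}\in A_1$. Then $$\mathcal{LI}(A_0,A_1;L^\infty)=\mathcal{M}(A_0,A_1).$$ Moreover, a couple of quasi-Banach r.i. spaces $(X_0,X_1)$ (satisfying the standing embedding assumption) belongs to this common class if and only if the quasilinear operator $$Q\varphi(t)=\frac{1}{\phi_{A_1}(t)}\,\|\varphi\,\chi_{[0,t]}\|_{A_0}$$ is bounded from $X_0$ into $X_1$ for nonincreasing functions, i.e. there is a constant $K$ with $\|Q\varphi\|_{X_1}\le K\|\varphi\|_{X_0}$ for all nonincreasing $\varphi\in X_0$.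
   Context: All functions are real-valued Lebesgue measurable on $I$; $f^*$ is the nonincreasing rearrangement of $f$. A Banach r.i. (rearrangement invariant) space on $I$ is a Banach space $(X,\|\cdot\|)$ of locally integrable functions on $I$ such that: (i) $|g|\le|f|$ a.e., $f\in X$ imply $g\in X$, $\|g\|\le\|f\|$; (ii) (Fatou) $0\le f_n\uparrow$, $\sup_n\|f_n\|<\infty$ imply $f=\sup f_n\in X$ and $\|f\|=\sup_n\|f_n\|$; (iii) $X$ contains the simple integrable functions; (iv) $f\in X\iff f^*\in X$, and $\|f\|=\|f^*\|$. A quasi-Banach r.i. space is a complete quasi-normed space of measurable functions satisfying (i)-(iv) (the triangle inequality holds with a constant; local integrability is not required). The fundamental function of $X$ is $\phi_X(t)=\|\chi_{[0,t]}\|_X$, $t\in I$. Let $(A_0,A_1)$ be a couple of quasi-Banach r.i. spaces. The classes below consist of couples $(X_0,X_1)$ of quasi-Banach r.i. spaces on $I$ satisfying the standing embedding assumption $A_i\cap L^\infty\hookrightarrow X_i\hookrightarrow A_i+L^\infty$, $i=0,1$ (continuous embeddings). $(X_0,X_1)\in\mathcal{LI}(A_0,A_1;L^\infty)$ if every linear operator $T:A_0+L^\infty\to A_1+L^\infty$ that is bounded from $A_0$ into $A_1$ and from $L^\infty$ into $L^\infty$ is also bounded from $X_0$ into $X_1$. $(X_0,X_1)\in\mathcal{M}(A_0,A_1)$ if there is a constant $C\ge1$ such that whenever $f\in X_0$, $g\in A_1+L^\infty$ and $\|f^*\chi_{[0,t]}\|_{A_0}\ge\|g^*\chi_{[0,t]}\|_{A_1}$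 for all $t>0$, then $g\in X_1$ and $\|g\|_{X_1}\le C\|f\|_{X_0}$. *)

(* Defs.v *)
From HB Require Import structures.
From mathcomp Require Import all_boot all_order all_algebra.
From mathcomp Require Import all_classical all_reals all_analysis.
Set Implicit Arguments.
Unset Strict Implicit.
Unset Printing Implicit Defensive.
Import Order.TTheory GRing.Theory Num.Theory.
Import numFieldNormedType.Exports.
Local Open Scope classical_set_scope.
Local Open Scope ring_scope.

(* The real line with the sigma-algebra of Lebesgue (not just Borel) measurable
   sets; [leb R] is convertible to [R]. *)
Notation leb R := (caratheodory_type (@wlength R idfun)^*%mu).
Definition lambda (R : realType) :
    {measure set (leb R) -> \bar R} :=
  @completed_lebesgue_measure R.

Section Defs.
Context {R : realType}.
Implicit Types (I : set R) (f g : R -> R).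

(* Functions on [I] are represented by total functions [R -> R] whose values
   outside [I] are irrelevant. *)
Definition lmeasurable I f : Prop :=
  measurable_fun (I : set (leb R)) (f : leb R -> R).

Definition aeon I (P : R -> Prop) : Prop :=
  {ae lambda R, forall x : leb R, I x -> P x}.

(* A set of functions with a size functional; [fnorm X f] is meaningful only
   when [X f] holds. *)
Record fspace := FSpace {
  fmem :> (R -> R) -> Prop;
  fnorm : (R -> R) -> R }.
Implicit Types X Y A : fspace.

(* Membership for extended real-valued functions: those finite a.e. *)
Definition emem I X (F : R -> \bar R) : Prop :=
  aeon I (fun x => F x \is a fin_num) /\ X (fine \o F).

Definition distribution_fun I f (s : R) : \bar R :=
  lambda R ([set x | I x /\ s < `|f x|] : set (leb R)).

(* [+oo] is the infimum of the empty set; in particular [rearr I f 0] may be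
   [+oo]. *)
Definition rearr I f (t : R) : \bar R :=
  ereal_inf
    [set s%:E | s in [set s | 0 <= s /\ (distribution_fun I f s <= t%:E)%E]].

(* The rearrangement as a real-valued function; it is faithful as soon as the
   rearrangement is finite a.e. *)
Definition rearrf I f : R -> R := fine \o rearr I f.

Definition quasi_normed I X : Prop :=
  [/\ forall f, X f -> lmeasurable I f /\ 0 <= fnorm X f,
      X (cst 0),
      forall f, X f -> (fnorm X f = 0 <-> aeon I (fun x => f x = 0)),
      forall (c : R) f, X f ->
        X (c \*o f) /\ fnorm X (c \*o f) = `|c| * fnorm X f
    & exists C : R, forall f g, X f -> X g ->
        X (f \+ g) /\ fnorm X (f \+ g) <= C * (fnorm X f + fnorm X g)].

Definition complete_fspace X : Prop :=
  forall f : nat -> R -> R, (forall n, X (f n)) ->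
    (forall e : R, 0 < e -> exists N, forall m n, (N <= m)%N -> (N <= n)%N ->
       fnorm X (f m \- f n) < e) ->
    exists2 g, X g & fnorm X (f n \- g) @[n --> \oo] --> 0.

Definition lattice_property I X : Prop :=
  forall f g, X f -> lmeasurable I g -> aeon I (fun x => `|g x| <= `|f x|) ->
    X g /\ fnorm X g <= fnorm X f.

Definition fatou_property I X : Prop :=
  forall f : nat -> R -> R, (forall n, X (f n)) ->
    aeon I (fun x => forall n, 0 <= f n x <= f n.+1 x) ->
    has_ubound (range (fun n => fnorm X (f n))) ->
    let F x := ereal_sup (range (fun n => (f n x)%:E)) in
    emem I X F /\ fnorm X (fine \o F) = sup (range (fun n => fnorm X (f n))).

Definition contains_simple I X : Prop :=
  forall f, lmeasurable I f -> finite_set (f @` I) ->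
    (lambda R).-integrable (I : set (leb R)) (EFin \o (f : leb R -> R)) -> X f.

Definition rearrangement_property I X : Prop :=
  forall f, lmeasurable I f ->
    (X f <-> emem I X (rearr I f)) /\
    (X f -> fnorm X f = fnorm X (rearrf I f)).

Definition quasi_banach_ri I X : Prop :=
  [/\ quasi_normed I X /\ complete_fspace X,
      lattice_property I X,
      fatou_property I X,
      contains_simple I X
    & rearrangement_property I X].

Definition banach_ri I X : Prop :=
  [/\ quasi_banach_ri I X,
      forall f g, X f -> X g -> fnorm X (f \+ g) <= fnorm X f + fnorm X g
    & forall f, X f -> forall K : set R, K `<=` I -> compact K ->
        (lambda R).-integrable (K : set (leb R))
          (EFin \o (f : leb R -> R))].

Definition phi X (t : R) : R := fnorm X \1_(`[0, t]%classic).

Definition Linfty_norm I f : \bar R :=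
  'N[lambda R]_+oo [EFin \o (f \_ I : leb R -> R)]%E.

Definition Linfty I : fspace :=
  FSpace (fun f => lmeasurable I f /\ (Linfty_norm I f < +oo)%E)
         (fun f => fine (Linfty_norm I f)).

Definition fcap X Y : fspace :=
  FSpace (fun f => X f /\ Y f)
         (fun f => Num.max (fnorm X f) (fnorm Y f)).

Definition fsum I X Y : fspace :=
  FSpace
    (fun f => lmeasurable I f /\
       exists a b, [/\ X a, Y b & aeon I (fun x => f x = a x + b x)])
    (fun f => inf [set r | exists a b,
       [/\ X a, Y b, aeon I (fun x => f x = a x + b x)
         & r = fnorm X a + fnorm Y b]]).

Definition embeds X Y : Prop :=
  exists C : R, forall f, X f -> Y f /\ fnorm Y f <= C * fnorm X f.

Definition bounded_op X Y (T : (R -> R) -> R -> R) : Prop :=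
  exists C : R, forall f, X f -> Y (T f) /\ fnorm Y (T f) <= C * fnorm X f.

(* Linear operators between spaces of classes of functions modulo a.e. equality
   on [I]. *)
Definition linear_op I X Y (T : (R -> R) -> R -> R) : Prop :=
  [/\ forall f, X f -> Y (T f),
      forall f g, X f -> X g -> aeon I (fun x => f x = g x) ->
        aeon I (fun x => T f x = T g x)
    & forall (c : R) f g, X f -> X g ->
        aeon I (fun x => T ((c \*o f) \+ g) x = c * T f x + T g x)].

Definition admissible I A0 A1 : set (fspace * fspace) :=
  [set X | [/\ quasi_banach_ri I X.1 /\ quasi_banach_ri I X.2,
               embeds (fcap A0 (Linfty I)) X.1,
               embeds X.1 (fsum I A0 (Linfty I)),
               embeds (fcap A1 (Linfty I)) X.2
             & embeds X.2 (fsum I A1 (Linfty I))]].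

Definition LI I A0 A1 : set (fspace * fspace) :=
  [set X | admissible I A0 A1 X /\
    forall T,
      linear_op I (fsum I A0 (Linfty I)) (fsum I A1 (Linfty I)) T ->
      bounded_op A0 A1 T -> bounded_op (Linfty I) (Linfty I) T ->
      bounded_op X.1 X.2 T].

Definition Mclass I A0 A1 : set (fspace * fspace) :=
  [set X | admissible I A0 A1 X /\
    exists2 C : R, 1 <= C &
      forall f g, X.1 f -> fsum I A1 (Linfty I) g ->
        (forall t : R, 0 < t ->
           fnorm A1 (rearrf I g \* \1_(`[0, t]%classic)) <=
           fnorm A0 (rearrf I f \* \1_(`[0, t]%classic))) ->
        X.2 g /\ fnorm X.2 g <= C * fnorm X.1 f].

(* The value at [0] is irrelevant, and is excluded so that functions unbounded
   near [0] are not ruled out. *)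
Definition nonincreasing_on I f : Prop :=
  forall x y, I x -> I y -> 0 < x -> x <= y -> f y <= f x.

Definition Qop A0 A1 f (t : R) : R :=
  (phi A1 t)^-1 * fnorm A0 (f \* \1_(`[0, t]%classic)).

Definition Q_bounded I A0 A1 X Y : Prop :=
  exists K : R, forall f, X f -> nonincreasing_on I f ->
    Y (Qop A0 A1 f) /\ fnorm Y (Qop A0 A1 f) <= K * fnorm X f.

End Defs.
Arguments fspace : clear implicits.

(* Main.v *)
Require Import Defs.
From HB Require Import structures.
From mathcomp Require Import all_boot all_order all_algebra.
From mathcomp Require Import all_classical all_reals all_analysis.
From mathcomp Require Import measurable_realfun ess_sup_inf ring lra.
Set Implicit Arguments.
Unset Strict Implicit.
Unset Printing Implicit Defensive.
Import Order.TTheory GRing.Theory Num.Theory.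
Import numFieldNormedType.Exports.
Local Open Scope classical_set_scope.
Local Open Scope ring_scope.

(* Writing phi_i for the fundamental function of A_i and chi_t for the indicator
   of [0, t], the two identities follow from the cycle M => LI => (Q bounded) => M
   for each admissible couple (X0, X1).

   M => LI.  Split f at the height tau = f^*(t) into f1 = f - f2 and its
   truncation f2 at +-tau.  Then f1^* <= f^* chi_t and |f2| <= tau, so
   (Tf)^* <= (Tf1)^* + |Tf2|_oo and phi_1 <= C phi_0 give
   |(Tf)^* chi_t|_A1 <= C' |f^* chi_t|_A0, and the condition M applies.

   LI => Q bounded.  Rounding s up to a power u(s) of 2, let L_u be a
   Hahn-Banach norming functional of f chi_u on A0, and put
   T g (s) = L_{u(s)} (g chi_{u(s)}) / phi_1(u(s)).  Since 1/phi_1 is in A1 and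
   phi_0 <= C phi_1, this linear T maps A0 to A1 and L^oo to L^oo, while
   Q f <= 2 C^2 T f by the doubling property phi_0(2s) <= 2 phi_0(s).  Hence Q
   maps X0 into X1; a gliding hump argument with the Fatou property makes this
   uniform.

   Q bounded => M.  g^*(t) phi_1(t) <= |g^* chi_t|_A1 <= |f^* chi_t|_A0, that is,
   g^* <= Q f^* pointwise. *)

(** * Norming functionals *)

Section hahn_banach.
Context {R : realType} {V : lmodType R} (D : V -> Prop) (p : V -> R).
Context (D_lin : forall c f g, D f -> D g -> D (c *: f + g))
  (p_add : forall f g, D f -> D g -> p (f + g) <= p f + p g)
  (p_scale : forall c f, D f -> p (c *: f) = `|c| * p f).

(** Partial functionals are encoded by their graphs in [V * R], so that a chain of them is bounded
    by its union. Single-valuedness is not imposed: domination by [p] at the vector [0] yields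
    it. *)
Let linear_graph (G : set (V * R)) :=
  forall c x y, G x -> G y -> G (c *: x.1 + y.1, c * x.2 + y.2).

Let dominated (G : set (V * R)) :=
  forall x, G x -> D x.1 /\ x.2 <= p x.1.

Lemma domain_scale f : D f -> forall c, D (c *: f).
Proof.
move=> Df c; have D0 : D 0 by rewrite -[0](addNr f) -scaleN1r; exact: D_lin.
by rewrite -[_ *: _]addr0; exact: D_lin.
Qed.

(** One-dimensional step of the Hahn-Banach theorem: the triangle inequality leaves room for a value
    [a] at [w] between all the lower bounds and all the upper bounds that domination prescribes. *)
Lemma graph_extension (G : set (V * R)) (w : V) :
  linear_graph G -> dominated G -> G !=set0 -> D w ->
  exists H, [/\ linear_graph H, dominated H, G `<=` H & exists a, H (w, a)].
Proof.
move=> linG domG [x0 Gx0] Dw.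
have G0 : G (0, 0).
  by have := linG (-1) _ _ Gx0 Gx0; rewrite scaleN1r mulN1r !addNr.
(* Domination at [x.1 + y.1 = (x.1 - w) + (y.1 + w)], followed by the triangle inequality. *)
have sep x y : G x -> G y -> x.2 - p (x.1 - w) <= p (y.1 + w) - y.2.
  move=> Gx Gy; have [Dx _] := domG _ Gx; have [Dy _] := domG _ Gy.
  have [_] := domG _ (linG 1 _ _ Gx Gy); rewrite /= scale1r mul1r => hxy.
  have : p ((x.1 - w) + (y.1 + w)) <= p (x.1 - w) + p (y.1 + w).
    apply: p_add; last by rewrite addrC -[w]scale1r; apply: D_lin.
    by rewrite addrC -scaleN1r; apply: D_lin.
  rewrite addrACA addNr addr0; lra.
(* Any [a] with [x.2 - p (x.1 - w) <= a <= p (y.1 + w) - y.2] is an admissible value at [w]. *)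
pose S := [set x.2 - p (x.1 - w) | x in G].
have supS : has_sup S.
  split; first by exists (x0.2 - p (x0.1 - w)); exists x0.
  by exists (p (x0.1 + w) - x0.2) => _ [x Gx <-]; exact: sep.
pose a := sup S.
have aL x : G x -> x.2 - p (x.1 - w) <= a.
  by move=> Gx; apply: ub_le_sup; [case: supS|exists x].
have aU x : G x -> a <= p (x.1 + w) - x.2.
  by move=> Gx; apply: ge_sup; [case: supS|move=> _ [y Gy <-]; exact: sep].
have scaleG c x : G x -> G (c *: x.1, c * x.2).
  by move=> Gx; have := linG c _ _ Gx G0; rewrite /= !addr0.
exists [set z | exists x c, G x /\ z = (x.1 + c *: w, x.2 + c * a)]; split.
- move=> c _ _ [x [d [Gx ->]]] [y [e [Gy ->]]].
  exists (c *: x.1 + y.1, c * x.2 + y.2), (c * d + e); split; first exact: linG.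
  congr (_, _) => /=; last ring.
  by rewrite scalerDr scalerA addrACA -scalerDl.
- move=> _ [x [c [Gx ->]]] /=; have [Dx px] := domG _ Gx; split.
    by rewrite addrC; apply: D_lin.
  (* Homogeneity reduces the coefficient of [w] to [-1] when [c < 0], which is the lower bound [aL],
     and to [1] when [c > 0], which is the upper bound [aU]. *)
  have [c0|c0|->] := ltgtP c 0; last by rewrite scale0r mul0r !addr0.
  + have := aL _ (scaleG (- c)^-1 _ Gx); rewrite /= => h.
    have -> : x.1 + c *: w = (- c) *: ((- c)^-1 *: x.1 - w).
      rewrite scalerBr scalerA divff ?scale1r ?oppr_eq0 ?lt_eqF//.
      by rewrite scaleNr opprK.
    rewrite p_scale; last first.
      by rewrite addrC -scaleN1r; apply: D_lin => //; exact: domain_scale.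
    rewrite gtr0_norm ?oppr_gt0// -ler_pdivrMl ?oppr_gt0//.
    rewrite mulrDr.
    have -> : (- c)^-1 * (c * a) = - a by field; rewrite ?oppr_eq0 lt_eqF.
    lra.
  + have := aU _ (scaleG c^-1 _ Gx); rewrite /= => h.
    have -> : x.1 + c *: w = c *: (c^-1 *: x.1 + w).
      by rewrite scalerDr scalerA divff ?scale1r ?gt_eqF.
    rewrite p_scale; last first.
      by rewrite addrC -[w]scale1r; apply: D_lin => //; exact: domain_scale.
    rewrite gtr0_norm// -ler_pdivrMl// mulrDr.
    have -> : c^-1 * (c * a) = a by field; rewrite gt_eqF.
    lra.
- by move=> x Gx; exists x, 0; split => //; rewrite scale0r mul0r !addr0; case: x Gx.
- by exists a, (0, 0), 1; split => //=; rewrite scale1r mul1r !add0r.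
Qed.

Lemma norming_functional v : D v -> exists L : V -> R,
  [/\ forall c f g, D f -> D g -> L (c *: f + g) = c * L f + L g,
      forall f, D f -> `|L f| <= p f & L v = p v].
Proof.
move=> Dv.
have p_ge0 f : D f -> 0 <= p f.
  move=> Df; have : p (f + (-1) *: f) <= p f + p ((-1) *: f).
    by apply: p_add => //; exact: domain_scale.
  rewrite -[f in f + _]scale1r -scalerDl addrN !p_scale// normr0 mul0r normrN1 mul1r; lra.
(* The requirement at [v] is conditional on [G] having a point, so that the union of the empty chain
   satisfies [P] as well. *)
pose P G := [/\ linear_graph G, dominated G & forall x, G x -> G (v, p v)].
have [|A [[linA domA Av] maxA]] := @Zorn_bigcup _ P.
  move=> F FP Ftot; split.
  - move=> c x y [G FG Gx] [H FH Hy].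
    have [GH|HG] := Ftot _ _ FG FH.
      by exists H => //; case: (FP _ FH) => + _ _; apply => //; exact: GH.
    by exists G => //; case: (FP _ FG) => + _ _; apply => //; exact: HG.
  - by move=> x [G FG Gx]; case: (FP _ FG) => _ + _; exact.
  - by move=> x [G FG Gx]; exists G => //; case: (FP _ FG) => _ _; apply; exact: Gx.
(* A maximal graph is not empty, because the line spanned by [(v, p v)] properly extends the empty
   graph. *)
have A0 : A !=set0.
  apply: contrapT => /set0P/negP; rewrite negbK => /eqP A0.
  pose G0 : set (V * R) := [set z | exists c, z = (c *: v, c * p v)].
  have G0v : G0 (v, p v) by exists 1; rewrite scale1r mul1r.
  apply: (maxA G0); first by rewrite A0; split => // /(_ _ G0v).
  split => //.
  - move=> c _ _ [d ->] [e ->]; exists (c * d + e).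
    by rewrite /= scalerDl scalerA mulrDl mulrA.
  - move=> _ [c ->] /=; split; first exact: domain_scale.
    by rewrite p_scale// ler_wpM2r ?p_ge0// ler_norm.
have {}Av : A (v, p v) by case: A0 => x /Av.
have totA w : D w -> exists r, A (w, r).
  move=> Dw; have [H [linH domH AH [a Ha]]] := graph_extension linA domA A0 Dw.
  apply: contrapT => nA; apply: (maxA H); first by
    split => // /(_ _ Ha) ?; apply: nA; exists a.
  by split => // x _; exact: AH.
have [L LA] : exists L : V -> R, forall w, D w -> A (w, L w).
  have /choice[L hL] : forall w, exists r, D w -> A (w, r).
    move=> w; have [Dw|nDw] := pselect (D w); last by exists 0.
    by have [r] := totA _ Dw; exists r.
  by exists L.
have funA w r s : A (w, r) -> A (w, s) -> r = s.
  move=> Ar As; apply: contrapT => /eqP; rewrite -subr_eq0 => rs.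
  have D0 : D 0 by have := domA _ (linA (-1) _ _ Ar Ar); rewrite /= scaleN1r addNr => -[].
  have p0 : p 0 = 0 by rewrite -(scale0r 0) p_scale// normr0 mul0r.
  have := domA _ (linA (-1) _ _ Ar As); have := domA _ (linA (-1) _ _ As Ar).
  rewrite /= !scaleN1r !addNr p0 => -[_ h1] [_ h2].
  by move/eqP: rs; apply; lra.
exists L; split.
- move=> c f g Df Dg; apply: (funA (c *: f + g)); first by apply: LA; exact: D_lin.
  exact: (linA c _ _ (LA _ Df) (LA _ Dg)).
- move=> f Df; rewrite ler_norml; apply/andP; split; last by case: (domA _ (LA _ Df)).
  (* The combination [-2 *: f + f] gives the point of the graph above [- f], whose domination is the
     lower bound for [L f]. *)
  have [_ /=] := domA _ (linA (-2) _ _ (LA _ Df) (LA _ Df)).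
  have -> : -2 *: f + f = (-1) *: f.
    by rewrite -[f in _ + f]scale1r -scalerDl; congr (_ *: _); ring.
  rewrite p_scale// normrN1 mul1r; lra.
- exact: funA (LA _ Dv) Av.
Qed.

End hahn_banach.

(** * Lebesgue measurable functions and decreasing rearrangements *)

Section ae.
Context {R : realType}.
Implicit Types (I : set R) (f g : R -> R).

Lemma aeonW I (P : R -> Prop) : (forall x, I x -> P x) -> aeon I P.
Proof. by move=> h; rewrite /aeon; apply: aeW => x; exact: h. Qed.

Lemma aeon_mp I (P Q : R -> Prop) :
  (forall x, I x -> P x -> Q x) -> aeon I P -> aeon I Q.
Proof. by move=> h; rewrite /aeon; apply: filterS => x Px Ix; apply: h => //; exact: Px. Qed.

Lemma aeon_and I (P Q : R -> Prop) :
  aeon I P -> aeon I Q -> aeon I (fun x => P x /\ Q x).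
Proof. by rewrite /aeon; apply: filterS2 => x h1 h2 Ix; split; [exact: h1|exact: h2]. Qed.

Lemma lmeasurable_set_borel (A : set R) :
  measurable A -> measurable (A : set (leb R)).
Proof. exact: sub_caratheodory. Qed.

Lemma lmeasurable_ext I f g : (forall x, I x -> f x = g x) ->
  lmeasurable I f -> lmeasurable I g.
Proof.
by move=> fg; apply: (@eq_measurable_fun _ _ (leb R) R I f g) => x; rewrite inE; exact: fg.
Qed.

Lemma lmeasurableD I f g : lmeasurable I f -> lmeasurable I g -> lmeasurable I (f \+ g).
Proof. exact: measurable_funD. Qed.

Lemma lmeasurableM I f g : lmeasurable I f -> lmeasurable I g -> lmeasurable I (f \* g).
Proof. exact: measurable_funM. Qed.

Lemma lmeasurable_cst I c : lmeasurable I (cst c).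
Proof. exact: measurable_cst. Qed.

Lemma lmeasurable_norm I f : lmeasurable I f -> lmeasurable I (fun x => `|f x|).
Proof. by move=> mf; exact: measurableT_comp. Qed.

Lemma lmeasurable_max I f g : lmeasurable I f -> lmeasurable I g ->
  lmeasurable I (fun x => Num.max (f x) (g x)).
Proof. exact: measurable_maxr. Qed.

Lemma lmeasurable_min I f g : lmeasurable I f -> lmeasurable I g ->
  lmeasurable I (fun x => Num.min (f x) (g x)).
Proof. exact: measurable_minr. Qed.

Lemma lmeasurable_indic I (A : set R) : measurable A -> lmeasurable I \1_A.
Proof. by move=> mA; apply: (@measurable_indic _ (leb R)); exact: lmeasurable_set_borel. Qed.

End ae.

(** * Distribution functions, decreasing rearrangements and truncation *)

Section rearr.
Context {R : realType} (I : set R) (hI : I = `[0, 1]%classic \/ I = `[0, +oo[%classic).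
Implicit Types (f g : R -> R).

Lemma I_itv : is_interval I.
Proof. by case: hI => ->; exact: interval_is_interval. Qed.

Lemma I_ge0 x : I x -> 0 <= x.
Proof. by case: hI => -> /=; rewrite in_itv/= => /andP[]. Qed.

Lemma I_le x y : 0 <= x -> x <= y -> I y -> I x.
Proof.
move=> x0 xy; case: hI => -> /=; rewrite !in_itv/= ?andbT// => /andP[_ y1].
by rewrite x0 (le_trans xy).
Qed.

Lemma I_1 : I 1.
Proof. by case: hI => -> /=; rewrite in_itv/= ler01// lexx. Qed.

(** The point [0] is a null set. It has to be discarded often, since a rearrangement may be infinite
    there. *)
Lemma aeon_pos (P : R -> Prop) : (forall x, I x -> 0 < x -> P x) -> aeon I P.
Proof.
move=> h; exists [set 0 : R]; split.
- apply: lmeasurable_set_borel; exact: measurable_set1.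
- exact: (@lebesgue_measure_set1 R 0).
- move=> x /= /not_implyP[Ix nP]; apply/eqP; apply: contra_notT nP => x0.
  by apply: h => //; rewrite lt_def x0 I_ge0.
Qed.

Lemma I_meas : measurable (I : set (leb R)).
Proof. by apply: lmeasurable_set_borel; apply: is_interval_measurable; exact: I_itv. Qed.

(** Among positive points each superlevel set is an interval; the point [0], which monotonicity
    leaves unconstrained, is split off. *)
Lemma lmeasurable_noninc f : nonincreasing_on I f -> lmeasurable I f.
Proof.
move=> fI; apply: (measurability (@RGenOInfty.G R) (RGenOInfty.measurableE R)).
move=> _ [_ [c ->] <-].
rewrite (_ : _ `&` _ = [set x | [/\ I x, 0 < x & c < f x]] `|`
   [set x | [/\ I x, x = 0 & c < f 0]]); last first.
  apply/seteqP; split=> x /=; rewrite in_itv/= andbT.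
    move=> [Ix cf]; have := I_ge0 Ix; rewrite le_eqVlt => /predU1P[x0|x0].
      by right; rewrite x0.
    by left.
  by case=> [[Ix _ cx]|[Ix x0 c0]]; split => //; rewrite x0.
apply: measurableU.
  apply: lmeasurable_set_borel; apply: is_interval_measurable.
  move=> x y /= [Ix x0 cx] [Iy y0 cy] z /andP[xz zy].
  have Iz : I z by apply: I_itv Ix Iy _ _; rewrite xz.
  split => //; first exact: lt_le_trans xz.
  by apply: lt_le_trans cy _; apply: fI => //; exact: lt_le_trans xz.
apply: lmeasurable_set_borel.
have [c0|c0] := boolP (c < f 0); last first.
  by rewrite (_ : mkset _ = set0)// -subset0 => x [].
have [I0|I0] := pselect (I 0).
  rewrite (_ : mkset _ = [set 0]); first exact: measurable_set1.
  by apply/seteqP; split => x /= [] // ->.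
by rewrite (_ : mkset _ = set0)// -subset0 => x [+ x0]; rewrite x0.
Qed.

Lemma superlevel_meas f s : lmeasurable I f ->
  measurable ([set x | I x /\ s < `|f x|] : set (leb R)).
Proof.
move=> mf; rewrite (_ : mkset _ = I `&` (fun x => `|f x|) @^-1` `]s, +oo[).
  by apply: (lmeasurable_norm mf); [exact: I_meas|exact: measurable_itv].
by apply/seteqP; split=> x /=; rewrite in_itv/= andbT.
Qed.

Lemma le_distr f g s s' : lmeasurable I f -> lmeasurable I g ->
  aeon I (fun x => s' < `|g x| -> s < `|f x|) ->
  (distribution_fun I g s' <= distribution_fun I f s)%E.
Proof.
move=> mf mg [N [mN N0 hN]]; rewrite /distribution_fun.
rewrite -[leRHS]adde0 -N0.
apply: le_trans (measureU2 _ (superlevel_meas s mf) mN).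
apply: le_measure; rewrite ?inE.
- exact: superlevel_meas.
- by apply: measurableU => //; exact: superlevel_meas.
- move=> x [Ix gx]; have [fx|fx] := boolP (s < `|f x|); [by left|right].
  by apply: hN => /= /(_ Ix gx); apply/negP.
Qed.

Lemma rearr_le f s t : 0 <= s -> (distribution_fun I f s <= t%:E)%E ->
  (rearr I f t <= s%:E)%E.
Proof. by move=> s0 st; apply: ereal_inf_lbound; exists s. Qed.

Lemma rearr_ge f y t :
  (forall s, 0 <= s -> (distribution_fun I f s <= t%:E)%E -> (y <= s%:E)%E) ->
  (y <= rearr I f t)%E.
Proof. by move=> h; apply: le_ereal_inf_tmp => _ [s [s0 st] <-]; exact: h. Qed.

Lemma rearr_lt f y t : (rearr I f t < y%:E)%E ->
  exists s, [/\ 0 <= s, s < y & (distribution_fun I f s <= t%:E)%E].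
Proof.
by move=> /ereal_inf_lt[_ [s [s0 st] <-]]; rewrite lte_fin => sy; exists s.
Qed.

Lemma rearr_ge0 f t : (0 <= rearr I f t)%E.
Proof. by apply: rearr_ge => s s0 _; rewrite lee_fin. Qed.

Lemma rearrf_ge0 f t : 0 <= rearrf I f t.
Proof. by apply: fine_ge0; exact: rearr_ge0. Qed.

Lemma rearr_noninc f t u : t <= u -> (rearr I f u <= rearr I f t)%E.
Proof.
move=> tu; apply: rearr_ge => s s0 st; apply: rearr_le => //.
by apply: le_trans st _; rewrite lee_fin.
Qed.

Lemma rearr_fin_le f t u : t <= u -> rearr I f t \is a fin_num -> rearr I f u \is a fin_num.
Proof.
move=> tu; rewrite !ge0_fin_numE ?rearr_ge0//; apply: le_lt_trans.
exact: rearr_noninc.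
Qed.

(** Where [|g| > s + b], also [|f| > s]; hence each level [s] that competes in the infimum for [f]
    yields the level [s + b] for [g]. *)
Lemma rearr_add_bounded f g b t : lmeasurable I f -> lmeasurable I g -> 0 <= b ->
  aeon I (fun x => `|g x| <= `|f x| + b) ->
  (rearr I g t <= rearr I f t + b%:E)%E.
Proof.
move=> mf mg b0 fg; rewrite -leeBlDr//; apply: rearr_ge => s s0 st.
rewrite leeBlDr// -EFinD; apply: rearr_le; first exact: addr_ge0.
apply: le_trans st; apply: le_distr => //; apply: aeon_mp fg => x _ h1 h2.
by rewrite -(ltrD2r b); exact: lt_le_trans h1.
Qed.

Lemma rearr_scale f c t : lmeasurable I f -> 0 < c ->
  (c%:E * rearr I f t <= rearr I (c \*o f) t)%E.
Proof.
move=> mf c0; apply: rearr_ge => s s0 st; rewrite -lee_pdivlMl// -EFinM.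
have mcf : lmeasurable I (c \*o f) by apply: lmeasurableM => //; exact: lmeasurable_cst.
apply: rearr_le; first by rewrite mulr_ge0// invr_ge0 ltW.
apply: le_trans st; apply: le_distr => //; apply: aeonW => x _ /=.
by rewrite normrM (gtr0_norm c0) ltr_pdivrMl.
Qed.

Definition clamp (b y : R) : R := Num.max (- b) (Num.min b y).

Lemma clamp_norm b y : 0 <= b -> `|clamp b y| <= b.
Proof.
move=> b0; rewrite ler_norml /clamp le_max lexx/= ge_max ge_min lexx/= andbT.
by rewrite (le_trans _ b0)// oppr_le0.
Qed.

Lemma clamp_dist b y : 0 <= b -> `|y - clamp b y| = Num.max 0 (`|y| - b).
Proof.
move=> b0; rewrite /clamp; case: (ltP b y) => yb; first last.
  case: (ltP (- b) y) => yNb.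
    by rewrite subrr normr0 max_l// subr_le0 ler_norml yb ltW.
  by rewrite opprK ler0_norm ?ler0_norm ?max_r; lra.
rewrite max_r; last lra.
by rewrite !ger0_norm ?max_r; lra.
Qed.

Lemma lmeasurable_clamp b f : lmeasurable I f -> lmeasurable I (clamp b \o f).
Proof.
move=> mf; apply: lmeasurable_max; first exact: lmeasurable_cst.
by apply: lmeasurable_min => //; exact: lmeasurable_cst.
Qed.

(** The excess over height [b] has modulus larger than [e] only where [|f| > b + e], and as [b] is
    the value of the rearrangement at [t] this set has measure at most [t]. *)
Lemma rearr_excess f b t r : lmeasurable I f -> 0 <= b ->
  rearr I f t = b%:E -> t <= r -> rearr I (f \- (clamp b \o f)) r = 0%E.
Proof.
move=> mf b0 fb tr; apply/eqP; rewrite eq_le rearr_ge0 andbT.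
apply/lee_addgt0Pr => e e0; rewrite add0e; apply: rearr_le; first exact: ltW.
have [s [s0 sb ds]] : exists s, [/\ 0 <= s, s < b + e & (distribution_fun I f s <= t%:E)%E].
  by apply: rearr_lt; rewrite fb lte_fin ltrDl.
apply: (@le_trans _ _ t%:E); last by rewrite lee_fin.
apply: le_trans ds; apply: le_distr => //.
  by apply: measurable_funB => //; exact: lmeasurable_clamp.
apply: aeonW => x _ /=; rewrite clamp_dist// lt_max (lt_gtF e0)/=; lra.
Qed.

(** The interval []0, a]] lies in [I] and has positive measure, so it is not contained in the
    exceptional null set. *)
Lemma aeon_exists (P : R -> Prop) (a : R) : aeon I P -> 0 < a -> I a ->
  exists x, [/\ 0 < x, x <= a & P x].
Proof.
move=> [N [mN N0 hN]] a0 Ia; apply: contrapT => noP.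
have : (lambda R `]0%R, a]%classic <= lambda R N)%E.
  apply: le_measure; rewrite ?inE//.
    by apply: lmeasurable_set_borel; exact: measurable_itv.
  move=> x /=; rewrite in_itv/= => /andP[x0 xa]; apply: hN => /= h.
  apply: noP; exists x; split => //; apply: h; apply: I_le Ia => //; exact: ltW.
rewrite N0 [lambda R _](@lebesgue_measure_itv R `]0, a])/= lte_fin a0 -EFinB subr0 lee_fin.
by apply/negP; rewrite -ltNge.
Qed.

(** Finiteness almost everywhere supplies a finite value at some point of []0, t]], and monotonicity
    carries it to [t]. *)
Lemma rearr_fin f t : aeon I (fun x => rearr I f x \is a fin_num) -> 0 < t ->
  rearr I f t \is a fin_num.
Proof.
move=> hf t0; have m0 : 0 < Num.min t 1 by rewrite lt_min t0 ltr01.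
have [|x [x0 xm fx]] := aeon_exists hf m0.
  by apply: I_le I_1; [exact: ltW|rewrite ge_min lexx orbT].
by apply: rearr_fin_le fx; rewrite (le_trans xm)// ge_min lexx.
Qed.

Lemma rearrf_noninc f : (forall t, 0 < t -> rearr I f t \is a fin_num) ->
  nonincreasing_on I (rearrf I f).
Proof.
move=> h x y Ix Iy x0 xy; rewrite /rearrf/=; apply: fine_le.
- by apply: h; exact: lt_le_trans xy.
- exact: h.
- exact: rearr_noninc.
Qed.

End rearr.

(** * Rearrangement invariant spaces *)

Section linfty.
Context {R : realType} (I : set R) (hI : I = `[0, 1]%classic \/ I = `[0, +oo[%classic).
Implicit Types (f g : R -> R).

(** The norm with exponent [+oo] unfolds to an essential supremum only when the whole space has
    positive measure. *)
Lemma lambdaT_gt0 : (0 < lambda R setT)%E.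
Proof.
rewrite [lambda R _](_ : _ = lebesgue_measure [set` `]-oo, +oo[]).
  by rewrite (@lebesgue_measure_itv R `]-oo, +oo[)/= addye ?ltry.
by rewrite /= set_itvE.
Qed.

Lemma Linfty_normE f :
  Linfty_norm I f = ess_sup (lambda R) (fun x : leb R => `|(f \_ I) x|%:E).
Proof. by rewrite /Linfty_norm Lnorm.unlock lambdaT_gt0. Qed.

Lemma Linfty_of_le f b : lmeasurable I f -> 0 <= b ->
  aeon I (fun x => `|f x| <= b) -> Linfty I f /\ fnorm (Linfty I) f <= b.
Proof.
move=> mf b0 fb.
have fb' : (Linfty_norm I f <= b%:E)%E.
  rewrite Linfty_normE; apply/ess_supP; move: fb; rewrite /aeon; apply: filterS => x h.
  rewrite patchE; case: ifPn => [|_]; last by rewrite normr0 lee_fin.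
  by rewrite inE lee_fin; exact: h.
have f0 : (0 <= Linfty_norm I f)%E by exact: Lnorm_ge0.
split; first by split => //; exact: le_lt_trans fb' (ltry _).
by rewrite /= -lee_fin fineK// ge0_fin_numE// (le_lt_trans fb') ?ltry.
Qed.

Lemma Linfty_le f : Linfty I f ->
  0 <= fnorm (Linfty I) f /\ aeon I (fun x => `|f x| <= fnorm (Linfty I) f).
Proof.
move=> [mf foo].
have f0 : (0 <= Linfty_norm I f)%E by exact: Lnorm_ge0.
split; first exact: fine_ge0.
have : (Linfty_norm I f <= (fnorm (Linfty I) f)%:E)%E.
  by rewrite /= fineK// ge0_fin_numE.
rewrite [leLHS]Linfty_normE => /ess_supP; rewrite /aeon; apply: filterS => x h Ix.
by move: h; rewrite patchE mem_set// lee_fin.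
Qed.

Lemma Linfty0 : Linfty I (cst 0).
Proof.
apply: (Linfty_of_le (b := 0) _ (lexx 0) _).1; first exact: lmeasurable_cst.
by apply: aeonW => x _; rewrite normr0.
Qed.

End linfty.

(** * Fundamental functions, and restrictions to [[0, t]] in one rearrangement invariant space *)

Section space.
Context {R : realType} (I : set R) (hI : I = `[0, 1]%classic \/ I = `[0, +oo[%classic).
Context (X : fspace R) (hX : quasi_banach_ri I X).
Implicit Types (f g : R -> R).

Lemma ri_meas f : X f -> lmeasurable I f.
Proof. by case: hX => -[[h _ _ _ _] _] _ _ _ _ /h[]. Qed.

Lemma ri_ge0 f : X f -> 0 <= fnorm X f.
Proof. by case: hX => -[[h _ _ _ _] _] _ _ _ _ /h[]. Qed.

Lemma ri_le f g : X f -> lmeasurable I g ->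
  aeon I (fun x => `|g x| <= `|f x|) -> X g /\ fnorm X g <= fnorm X f.
Proof. by case: hX => _ + _ _ _; exact. Qed.

Lemma ri_eq f g : X f -> lmeasurable I g ->
  aeon I (fun x => g x = f x) -> X g /\ fnorm X g = fnorm X f.
Proof.
move=> Xf mg fg; have [|Xg gf] := ri_le Xf mg.
  by apply: aeon_mp fg => x _ ->.
split => //; apply/eqP; rewrite eq_le gf/=; apply: (ri_le Xg _ _).2.
  exact: ri_meas.
by apply: aeon_mp fg => x _ ->.
Qed.

Lemma ri_scale c f : X f -> X (c \*o f) /\ fnorm X (c \*o f) = `|c| * fnorm X f.
Proof. by case: hX => -[[_ _ _ h _] _] _ _ _ _; exact: h. Qed.

Lemma ri_tri : exists2 C : R, 1 <= C & forall f g, X f -> X g ->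
  X (f \+ g) /\ fnorm X (f \+ g) <= C * (fnorm X f + fnorm X g).
Proof.
case: hX => -[[_ _ _ _ [C hC]] _] _ _ _ _; exists (Num.max 1 C).
  by rewrite le_max lexx.
move=> f g Xf Xg; have [Xfg le] := hC _ _ Xf Xg; split => //.
apply: le_trans le _; apply: ler_wpM2r; last by rewrite le_max lexx orbT.
by rewrite addr_ge0// ri_ge0.
Qed.

Lemma ri_indic (A : set R) : measurable A -> (lebesgue_measure A < +oo)%E -> X \1_A.
Proof.
move=> mA Afin; case: hX => _ _ _ hs _; apply: hs.
- exact: lmeasurable_indic.
- apply: (@sub_finite_set _ _ [set 0; 1]) => [_ [x _ <-]|].
    by rewrite indicE; case: (x \in A); [right|left].
  by rewrite finite_setU; split; exact: finite_set1.
- apply/integrableP; split.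
    by apply/measurable_EFinP; exact: lmeasurable_indic.
  under eq_integral do rewrite /= normr_nat.
  rewrite (@integral_indic _ (leb R) R (lambda R) I (I_meas hI) A);
    last exact: lmeasurable_set_borel.
  apply: (@le_lt_trans _ _ (lambda R A)); last exact: Afin.
  apply: le_measure; rewrite ?inE.
  + by apply: measurableI; [exact: lmeasurable_set_borel|exact: I_meas].
  + exact: lmeasurable_set_borel.
  + by move=> x [].
Qed.

Lemma ri_itv (a b : R) (c d : bool) : X \1_([set` Interval (BSide c a) (BSide d b)]).
Proof.
apply: ri_indic; first exact: measurable_itv.
by rewrite lebesgue_measure_itv/=; case: ifP => // _; rewrite -EFinB ltry.
Qed.

Lemma ri_rearr f : X f ->
  [/\ aeon I (fun x => rearr I f x \is a fin_num), X (rearrf I f) &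
      fnorm X f = fnorm X (rearrf I f)].
Proof.
move=> Xf; case: hX => _ _ _ _ h; have [[h1 _] h2] := h _ (ri_meas Xf).
by have [fin Xr] := h1 Xf; split => //; exact: h2.
Qed.

Lemma ri_of_rearr f : lmeasurable I f ->
  (forall t, 0 < t -> rearr I f t \is a fin_num) -> X (rearrf I f) ->
  X f /\ fnorm X f = fnorm X (rearrf I f).
Proof.
move=> mf fin Xr; case: hX => _ _ _ _ h; have [[_ h1] h2] := h _ mf.
have Xf : X f.
  apply: h1; split => //; apply: (aeon_pos hI) => x Ix x0; exact: fin.
by split => //; exact: h2.
Qed.

Lemma ri_equidistr f g : lmeasurable I f -> lmeasurable I g ->
  (forall s, 0 <= s -> distribution_fun I f s = distribution_fun I g s) ->
  X f -> X g -> fnorm X f = fnorm X g.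
Proof.
move=> mf mg fg Xf Xg; have [_ _ ->] := ri_rearr Xf; have [_ _ ->] := ri_rearr Xg.
congr (fnorm X _); apply/funext => t; rewrite /rearrf/=; congr (fine (ereal_inf _)).
apply/seteqP; split => _ [s [s0 ds] <-]; exists s => //; split => //.
  by rewrite -fg.
by rewrite fg.
Qed.

Lemma phi_ge0 t : 0 <= phi X t.
Proof. by apply: ri_ge0; exact: ri_itv. Qed.

Lemma phi_le s t : s <= t -> phi X s <= phi X t.
Proof.
move=> st; apply: (ri_le _ _ _).2; first exact: ri_itv.
  exact: lmeasurable_indic.
apply: aeonW => x _; rewrite !indicE !normr_nat ler_nat.
case: (boolP (x \in `[0, s]%classic)) => //; rewrite inE/= in_itv/= => /andP[x0 xs].
by rewrite mem_set//= in_itv/= x0 (le_trans xs).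
Qed.

(** Norm zero would make the indicator vanish almost everywhere, yet it equals [1] at a point of
    []0, min(t, 1)]]; the minimum with [1] stays inside [I] in both cases. *)
Lemma phi_gt0 t : 0 < t -> 0 < phi X t.
Proof.
move=> t0; rewrite lt_def phi_ge0 andbT; apply/eqP.
case: hX => -[[_ _ h _ _] _] _ _ _ _.
have /h[+ _] : X \1_`[0, t]%classic by exact: ri_itv.
move=> /[apply] h0.
have m0 : 0 < Num.min t 1 by rewrite lt_min t0 ltr01.
have [|x [x0 xm]] := aeon_exists hI h0 m0.
  by apply: (I_le hI _ _ (I_1 hI)); [exact: ltW|rewrite ge_min lexx orbT].
rewrite indicE mem_set/=; first by move/eqP; rewrite oner_eq0.
by rewrite in_itv/= (ltW x0) (le_trans xm)// ge_min lexx.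
Qed.

(** Only [I = [0, 1]] leaves such [t], and then both indicators equal [1] on [I]. This carries
    comparisons of fundamental functions from [I] to every [t >= 0]. *)
Lemma phi_notin t : 0 <= t -> ~ I t -> phi X t = phi X 1.
Proof.
move=> t0 nIt; have t1 : 1 <= t.
  rewrite leNgt; apply/negP => t1; apply: nIt.
  by apply: I_le (ltW t1) (I_1 hI).
have [I01|I0y] := hI; last by case: nIt; rewrite I0y/= in_itv/= t0.
apply: (ri_eq _ _ _).2; first exact: ri_itv.
  exact: lmeasurable_indic.
apply: aeonW => x; rewrite I01/= in_itv/= => /andP[x0 x1].
by rewrite !indicE !mem_set//= in_itv/= x0// (le_trans x1).
Qed.

(** On []0, t]] the rearrangement is at least its value at [t]. *)
Lemma rearrf_phi_le f t : lmeasurable I (rearrf I f) ->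
  (forall t, 0 < t -> rearr I f t \is a fin_num) -> 0 < t ->
  X (rearrf I f \* \1_(`[0, t]%classic)) ->
  rearrf I f t * phi X t <= fnorm X (rearrf I f \* \1_(`[0, t]%classic)).
Proof.
move=> mr fin t0 Xr; have r0 : 0 <= rearrf I f t by exact: rearrf_ge0.
have Xc : X \1_(`[0, t]%classic) by exact: ri_itv.
have [Xrc] := ri_scale (rearrf I f t) Xc; rewrite ger0_norm// => <-.
apply: (ri_le Xr _ _).2; first exact: ri_meas.
apply: (aeon_pos hI) => x Ix x0 /=; rewrite indicE.
have [|] := boolP (x \in `[0, t]%classic); last by rewrite !mulr0.
rewrite inE/= in_itv/= !mulr1 => /andP[_ xt].
rewrite !ger0_norm//; last exact: rearrf_ge0.
by apply: fine_le; [exact: fin|exact: fin|exact: rearr_noninc].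
Qed.

(** Peeling off the first term each time charges one factor [C] per step, hence the weight
    [C ^+ i.+1] on the term of index [i]. *)
Lemma ri_finite_sum (C : R) (g : nat -> R -> R) (N : nat) :
  (forall f g, X f -> X g ->
    X (f \+ g) /\ fnorm X (f \+ g) <= C * (fnorm X f + fnorm X g)) ->
  0 <= C -> (forall i, X (g i)) ->
  X (fun x => \sum_(i < N) g i x) /\
  fnorm X (fun x => \sum_(i < N) g i x) <= \sum_(i < N) C ^+ i.+1 * fnorm X (g i).
Proof.
move=> tri C0; elim: N g => [|N IH] g Xg.
  rewrite big_ord0; under eq_fun do rewrite big_ord0.
  case: hX => -[[_ X0 _ h _] _] _ _ _ _.
  have [] := h 0 _ X0; rewrite normr0 mul0r.
  have -> : 0 \*o cst 0 = cst 0 :> (R -> R) by apply/funext => x /=; rewrite mul0r.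
  by move=> _ ->.
have [Xs sle] := IH (fun i => g i.+1) (fun i => Xg i.+1).
have [Xgs gsle] := tri _ _ (Xg 0%N) Xs.
rewrite (_ : (fun x => _) = g 0%N \+ (fun x => \sum_(i < N) g i.+1 x)); last first.
  by apply/funext => x; rewrite big_ord_recl.
split => //; apply: le_trans gsle _; rewrite big_ord_recl mulrDr expr1 lerD2l.
apply: le_trans (ler_wpM2l C0 sle) _; rewrite mulr_sumr.
by apply: ler_sum => i _; rewrite mulrA -exprS.
Qed.

Lemma lmeasurable_chi f t : lmeasurable I f -> lmeasurable I (f \* \1_(`[0, t]%classic)).
Proof. by move=> mf; apply: lmeasurableM => //; exact: lmeasurable_indic. Qed.

Lemma ri_chi f t : X f -> X (f \* \1_(`[0, t]%classic)) /\
  fnorm X (f \* \1_(`[0, t]%classic)) <= fnorm X f.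
Proof.
move=> Xf; apply: ri_le => //; first by apply: lmeasurable_chi; exact: ri_meas.
apply: aeonW => x _ /=; rewrite normrM indicE normr_nat.
by case: (_ \in _); rewrite ?mulr1// mulr0.
Qed.

Lemma ri_bounded_chi f b t : lmeasurable I f -> 0 <= b ->
  aeon I (fun x => `|f x| <= b) ->
  X (f \* \1_(`[0, t]%classic)) /\ fnorm X (f \* \1_(`[0, t]%classic)) <= b * phi X t.
Proof.
move=> mf b0 fb; have Xc : X \1_(`[0, t]%classic) by exact: ri_itv.
have [Xbc] := ri_scale b Xc; rewrite (ger0_norm b0) => <-.
apply: ri_le => //; first exact: lmeasurable_chi.
apply: aeon_mp fb => x _ /= fb; rewrite !normrM (ger0_norm b0).
exact: ler_wpM2r.
Qed.

Lemma fsum_l f : X f -> fsum I X (Linfty I) f.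
Proof.
move=> Xf; split; first exact: ri_meas.
exists f, (cst 0); split => //; first exact: Linfty0.
by apply: aeonW => x _; rewrite addr0.
Qed.

Lemma fsum_r f : Linfty I f -> fsum I X (Linfty I) f.
Proof.
move=> Lf; split; first by case: Lf.
exists (cst 0), f; split => //; first by case: hX => -[[]].
by apply: aeonW => x _; rewrite add0r.
Qed.

Lemma ri_sum_chi f t : fsum I X (Linfty I) f -> X (f \* \1_(`[0, t]%classic)).
Proof.
move=> [mf [a [b [Xa Lb fab]]]]; have [b0 bb] := Linfty_le Lb.
have [C _ tri] := ri_tri.
have [Xab _] := tri _ _ (ri_chi t Xa).1 (ri_bounded_chi t (proj1 Lb) b0 bb).1.
apply: (ri_eq Xab _ _).1; first exact: lmeasurable_chi.
by apply: aeon_mp fab => x _ /= ->; rewrite mulrDl.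
Qed.

Lemma sum_rearr f a b t : lmeasurable I f -> X a -> Linfty I b ->
  aeon I (fun x => f x = a x + b x) -> 0 < t ->
  rearr I f t \is a fin_num /\
  rearrf I f t <= rearrf I a t + fnorm (Linfty I) b.
Proof.
move=> mf Xa Lb fab t0; have [b0 bb] := Linfty_le Lb.
have [fina _ _] := ri_rearr Xa; have fa := rearr_fin hI fina t0.
have le : (rearr I f t <= rearr I a t + (fnorm (Linfty I) b)%:E)%E.
  apply: (rearr_add_bounded hI) => //; first exact: ri_meas.
  apply: aeon_mp (aeon_and fab bb) => x _ [-> h].
  by apply: le_trans (ler_normD _ _) _; rewrite lerD2l.
have ff : rearr I f t \is a fin_num.
  by rewrite ge0_fin_numE ?rearr_ge0// (le_lt_trans le)// -(fineK fa) -EFinD ltry.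
by split => //; move: le; rewrite -(fineK fa) -(fineK ff) -EFinD lee_fin.
Qed.

Lemma sum_rearr_fin f t : fsum I X (Linfty I) f -> 0 < t -> rearr I f t \is a fin_num.
Proof. by move=> [mf [a [b [Xa Lb fab]]]] t0; have [] := sum_rearr mf Xa Lb fab t0. Qed.

Lemma sum_rearr_meas f : fsum I X (Linfty I) f -> lmeasurable I (rearrf I f).
Proof.
move=> Sf; apply: (lmeasurable_noninc hI); apply: rearrf_noninc => t.
exact: sum_rearr_fin.
Qed.

(** Pointwise the rearrangement of [f] is at most that of [a] plus the sup norm of [b]. The constant
    is that of the quasi-triangle inequality, and so does not depend on [t]. *)
Lemma sum_rearr_chi : exists2 C : R, 1 <= C & forall f a b t,
  lmeasurable I f -> X a -> Linfty I b -> aeon I (fun x => f x = a x + b x) ->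
  X (rearrf I f \* \1_(`[0, t]%classic)) /\
  fnorm X (rearrf I f \* \1_(`[0, t]%classic)) <=
    C * (fnorm X a + fnorm (Linfty I) b * phi X t).
Proof.
have [C C1 tri] := ri_tri; exists C => // f a b t mf Xa Lb fab.
have Sf : fsum I X (Linfty I) f by split => //; exists a, b.
have [b0 _] := Linfty_le Lb; have [_ Xr ar] := ri_rearr Xa.
have mc : lmeasurable I (cst (fnorm (Linfty I) b)) by exact: lmeasurable_cst.
have [|Xc cle] := ri_bounded_chi t mc b0.
  by apply: aeonW => x _; rewrite ger0_norm.
have [Xra rale] := ri_chi t Xr.
have [Xac acle] := tri _ _ Xra Xc.
have [|Xf fle] := ri_le Xac (lmeasurable_chi t (sum_rearr_meas Sf)).
  apply: (aeon_pos hI) => x Ix x0 /=.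
  rewrite -mulrDl !normrM; apply: ler_wpM2r => //.
  rewrite !ger0_norm ?addr_ge0 ?rearrf_ge0//.
  by have [] := sum_rearr mf Xa Lb fab x0.
split => //; apply: le_trans fle _; apply: le_trans acle _.
by rewrite ler_pM2l ?(lt_le_trans _ C1)// ar lerD.
Qed.

End space.

(** * From Q to M, and from M to LI *)

Section main.
Context {R : realType} (I : set R) (hI : I = `[0, 1]%classic \/ I = `[0, +oo[%classic).
Context (A0 A1 : fspace R) (hA0 : quasi_banach_ri I A0) (hA1 : quasi_banach_ri I A1).
Implicit Types (f g : R -> R).

Lemma Q_bounded_Mclass X0 X1 : admissible I A0 A1 (X0, X1) ->
  Q_bounded I A0 A1 X0 X1 -> Mclass I A0 A1 (X0, X1).
Proof.
move=> adm [K hK]; split => //; exists (Num.max 1 K); first by rewrite le_max lexx.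
case: adm => /= -[hX0 hX1] _ eX0 _ eX1 f g Xf Sg dom.
have [finf Xr fr] := ri_rearr hX0 Xf.
have fin t : 0 < t -> rearr I f t \is a fin_num := rearr_fin hI finf.
have [XQ QK] := hK _ Xr (rearrf_noninc fin).
have fing t : 0 < t -> rearr I g t \is a fin_num := sum_rearr_fin hI hA1 Sg.
have mrg := sum_rearr_meas hI hA1 Sg.
have [C _ chi] := sum_rearr_chi hI hA1.
(* The rearrangement of [f] is nonincreasing, so [Q] may be applied to it; the result dominates the
   rearrangement of [g] at every positive point. *)
have [|Xg gle] := ri_le hX1 XQ mrg.
  apply: (aeon_pos hI) => x Ix x0.
  have px := phi_gt0 hI hA1 x0.
  rewrite ger0_norm; last exact: rearrf_ge0.
  apply: le_trans (ler_norm _).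
  rewrite /Qop ler_pdivlMl// mulrC; apply: le_trans (dom x x0).
  apply: rearrf_phi_le => //.
  by have [mg [a [b [Xa Lb gab]]]] := Sg; have [] := chi g a b x.
have [Xg' ->] := ri_of_rearr hI hX1 (proj1 Sg) fing Xg.
split => //; apply: le_trans gle _; apply: le_trans QK _.
rewrite -fr ler_wpM2r ?le_max ?lexx ?orbT//; exact: (ri_ge0 hX0 Xf).
Qed.

Context (Cp : R) (Cp0 : 0 < Cp)
  (hphi : forall t, I t -> Cp^-1 * phi A1 t <= phi A0 t <= Cp * phi A1 t).

Lemma phi_le10 t : 0 <= t -> phi A1 t <= Cp * phi A0 t.
Proof.
have h s : I s -> phi A1 s <= Cp * phi A0 s.
  by move=> /hphi/andP[+ _]; rewrite ler_pdivrMl.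
move=> t0; have [|nIt] := pselect (I t); first exact: h.
by rewrite (phi_notin hI hA0 t0 nIt) (phi_notin hI hA1 t0 nIt); apply: h; exact: (I_1 hI).
Qed.

(** Up to [t] the rearrangement of [f1] is at most that of [f], and beyond [t] it vanishes by
    [rearr_excess]. *)
Lemma excess_in_A0 f t : fsum I A0 (Linfty I) f -> 0 < t ->
  let f1 := f \- (clamp (rearrf I f t) \o f) in
  A0 f1 /\ fnorm A0 f1 <= fnorm A0 (rearrf I f \* \1_(`[0, t]%classic)).
Proof.
move=> Sf t0; set b := rearrf I f t => f1.
have mf : lmeasurable I f by case: Sf.
have fin s : 0 < s -> rearr I f s \is a fin_num := sum_rearr_fin hI hA0 Sf.
have b0 : 0 <= b by exact: rearrf_ge0.
have mf1 : lmeasurable I f1 by apply: measurable_funB => //; exact: lmeasurable_clamp.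
have r1 s : (rearr I f1 s <= rearr I f s)%E.
  rewrite -[leRHS]adde0; apply: (rearr_add_bounded hI) => //.
  apply: aeonW => x _; rewrite /f1/= clamp_dist// addr0 ge_max normr_ge0/=.
  by rewrite gerBl.
have fin1 s : 0 < s -> rearr I f1 s \is a fin_num.
  move=> /fin; rewrite !ge0_fin_numE ?rearr_ge0//; exact: le_lt_trans.
have [C _ chi] := sum_rearr_chi hI hA0.
have Af : A0 (rearrf I f \* \1_(`[0, t]%classic)).
  by have [_ [a [c [Xa Lc fac]]]] := Sf; have [] := chi f a c t.
have mr1 : lmeasurable I (rearrf I f1).
  by apply: (lmeasurable_noninc hI); exact: rearrf_noninc.
have [|Ar1 r1le] := ri_le hA0 Af mr1.
  apply: (aeon_pos hI) => x Ix x0 /=; rewrite indicE.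
  have [xt|tx] := leP x t.
    rewrite mem_set/= ?in_itv/= ?(ltW x0)// mulr1.
    rewrite !ger0_norm; try exact: rearrf_ge0.
    by apply: fine_le; [exact: fin1|exact: fin|exact: r1].
  rewrite /rearrf/= (@rearr_excess _ _ hI _ _ t)//= ?normr0 ?normr_ge0 ?(ltW tx)//.
  by rewrite fineK// fin.
by have [Af1 ->] := ri_of_rearr hI hA0 mf1 fin1 Ar1.
Qed.

Lemma Mclass_LI X0 X1 : Mclass I A0 A1 (X0, X1) -> LI I A0 A1 (X0, X1).
Proof.
move=> [adm [C C1 hM]]; split => // T [Tsum _ Tlin] [c0 hc0] [c1 hc1].
case: adm => /= -[hX0 hX1] _ [e0 eX0] _ _.
have [Cs Cs1 chi1] := sum_rearr_chi hI hA1.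
have [C0 _ chi0] := sum_rearr_chi hI hA0.
have Cs0 : 0 < Cs by exact: lt_le_trans Cs1.
(* [Cs] comes from [sum_rearr_chi] in [A1], [c0] bounds [T] on the excess, and [c1 * Cp] bounds it
   on the truncation after passing from [phi A1] to [phi A0]. The added [1] makes [B] positive. *)
pose B := Cs * (`|c0| + `|c1| * Cp) + 1.
have B0 : 0 < B.
  by rewrite ltr_wpDl// mulr_ge0 ?(ltW Cs0)// addr_ge0// mulr_ge0// ltW.
exists (C * B) => f Xf.
have Sf := (eX0 _ Xf).1.
have [XBf nBf] := ri_scale hX0 B Xf.
have SBf := (eX0 _ XBf).1.
rewrite gtr0_norm// in nBf; rewrite -mulrA -nBf.
have STf := Tsum _ Sf.
have fin s : 0 < s -> rearr I f s \is a fin_num := sum_rearr_fin hI hA0 Sf.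
(* The condition M compares norms without a constant, so the factor [B] is absorbed into the
   function. *)
apply: (hM (B \*o f) (T f)) => // t t0.
have [] := excess_in_A0 Sf t0; set b := rearrf I f t; set f1 := _ \- _.
set N := fnorm A0 (rearrf I f \* _) => Af1 f1N.
have mf : lmeasurable I f by case: Sf.
have b0 : 0 <= b by exact: rearrf_ge0.
have Af : A0 (rearrf I f \* \1_(`[0, t]%classic)).
  by have [_ [a [c [Xa Lc fac]]]] := Sf; have [] := chi0 f a c t.
have N0 : 0 <= N by exact: (ri_ge0 hA0 Af).
have [Lf2 f2b] : Linfty I (clamp b \o f) /\ fnorm (Linfty I) (clamp b \o f) <= b.
  apply: Linfty_of_le => //; first exact: lmeasurable_clamp.
  by apply: aeonW => x _; exact: clamp_norm.
have Sf1 : fsum I A0 (Linfty I) f1 := fsum_l hA0 Af1.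
have Sf2 : fsum I A0 (Linfty I) (clamp b \o f) := fsum_r hA0 Lf2.
have := Tlin 1 _ _ Sf1 Sf2.
have -> : (1 \*o f1) \+ (clamp b \o f) = f.
  by apply/funext => x; rewrite /f1/= mul1r subrK.
have [AT1 T1] := hc0 _ Af1; have [LT2 T2] := hc1 _ Lf2 => Tf.
have [|_ Tle] := chi1 (T f) (T f1) (T (clamp b \o f)) t (proj1 STf) AT1 LT2.
  by apply: aeon_mp Tf => x _ ->; rewrite mul1r.
have ABf : A0 (rearrf I (B \*o f) \* \1_(`[0, t]%classic)).
  by have [mBf [a [c [Xa Lc fac]]]] := SBf; have [] := chi0 (B \*o f) a c t.
have BN : B * N <= fnorm A0 (rearrf I (B \*o f) \* \1_(`[0, t]%classic)).
  have [ABr] := ri_scale hA0 B Af; rewrite (gtr0_norm B0) => <-.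
  apply: (ri_le hA0 ABf _ _).2; first exact: (ri_meas hA0).
  apply: (aeon_pos hI) => x Ix x0 /=; rewrite indicE.
  rewrite mulrA normrM [leRHS]normrM; apply: ler_wpM2r => //.
  have r0 g : 0 <= rearrf I g x by exact: rearrf_ge0.
  rewrite !ger0_norm ?mulr_ge0 ?r0 ?(ltW B0)//.
  have := rearr_scale hI x mf B0.
  by rewrite -(fineK (fin _ x0)) -(fineK (sum_rearr_fin hI hA0 SBf x0)) -EFinM lee_fin.
(* The contribution of the truncation, height times fundamental function, is controlled by the same
   norm [N] as the excess. *)
have bN : b * phi A0 t <= N.
  by apply: (rearrf_phi_le hI hA0) => //; exact: (sum_rearr_meas hI hA0).
apply: le_trans Tle _; apply: le_trans BN; rewrite /B mulrDl mul1r -mulrA.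
apply: ler_wpDr => //; rewrite ler_pM2l// mulrDl; apply: lerD.
  apply: le_trans T1 _; apply: (@le_trans _ _ (`|c0| * fnorm A0 f1)).
    by apply: ler_wpM2r; [exact: (ri_ge0 hA0 Af1)|exact: ler_norm].
  by apply: ler_wpM2l.
have [f20 _] := Linfty_le Lf2.
have T2' : fnorm (Linfty I) (T (clamp b \o f)) <= `|c1| * b.
  apply: le_trans T2 _; apply: (@le_trans _ _ (`|c1| * fnorm (Linfty I) (clamp b \o f))).
    by apply: ler_wpM2r => //; exact: ler_norm.
  exact: ler_wpM2l.
apply: (@le_trans _ _ (`|c1| * b * phi A1 t)).
  by apply: ler_wpM2r => //; exact: (phi_ge0 hI hA1).
rewrite -!mulrA; apply: ler_wpM2l => //.
apply: (@le_trans _ _ (b * (Cp * phi A0 t))).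
  by apply: ler_wpM2l => //; apply: phi_le10; exact: ltW.
by rewrite mulrCA ler_pM2l.
Qed.

End main.

(** * From LI to Q *)

Section dyadic.
Context {R : realType}.

(** For [s > 0], [dyadic_up s] is the least power of 2 not below [s]. Only countably many scales
    occur, which is what makes an arbitrary choice of functionals, one per scale, measurable in
    [s]. *)
Definition dyadic_exp (s : R) : int := Num.ceil (ln s / ln 2).
Definition dyadic_up (s : R) : R := expR (ln 2 * (dyadic_exp s)%:~R).

Lemma dyadic_up_gt0 s : 0 < dyadic_up s.
Proof. exact: expR_gt0. Qed.

Lemma dyadic_up_bounds s : 0 < s -> s <= dyadic_up s <= 2 * s.
Proof.
move=> s0; have l2 : 0 < ln 2 :> R by rewrite ln_gt0// ltr1n.
have /andP[h1 h2] := ceil_itv (ln s / ln 2).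
have es : s = expR (ln s) by rewrite lnK.
have e2s : 2 * s = expR (ln 2 + ln s) by rewrite expRD !lnK ?posrE.
apply/andP; split.
  by rewrite {1}es ler_expR -ler_pdivrMl// mulrC.
rewrite e2s ler_expR /dyadic_exp; move: h1; rewrite intrD ltrBlDr => /ltW.
rewrite -(ler_pM2l l2) => /le_trans; apply.
by rewrite mulrDr mulr1 mulrC divfK ?gt_eqF// addrC.
Qed.

(** As [1] is itself a power of 2, rounding up does not leave [[0, 1]]. *)
Lemma dyadic_up_le1 s : s <= 1 -> dyadic_up s <= 1.
Proof.
move=> s1; have l2 : 0 < ln 2 :> R by rewrite ln_gt0// ltr1n.
rewrite -expR0 ler_expR pmulr_rle0//.
rewrite lerz0 ceil_le0 pmulr_lle0 ?invr_gt0//.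
exact: ln_le0.
Qed.

(** The function [h] is arbitrary: a preimage is a countable union of level sets of [dyadic_exp],
    each being the preimage of some []k - 1, k]] under [ln s / ln 2]. *)
Lemma lmeasurable_dyadic (I : set R) (h : int -> R) :
  measurable (I : set (leb R)) -> lmeasurable I (h \o dyadic_exp).
Proof.
move=> mI _ B mB.
have -> : I `&` (h \o dyadic_exp) @^-1` B =
    \bigcup_k (I `&` [set s | dyadic_exp s = k /\ B (h k)]).
  apply/seteqP; split=> [s [Is Bs]|s [k _ [Is [<- Bk]]]//].
  by exists (dyadic_exp s).
apply: countable_bigcupT_measurable => // k; apply: measurableI => //.
have [Bk|nBk] := pselect (B (h k)); last first.
  by rewrite (_ : mkset _ = set0)// -subset0 => x [].
have -> : [set s | dyadic_exp s = k /\ B (h k)] =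
    setT `&` (fun s : R => ln s / ln 2) @^-1` `](k - 1)%:~R, k%:~R]%classic.
  apply/seteqP; split=> s /=; rewrite in_itv/= /dyadic_exp.
    by move=> [<- _]; split => //; exact: ceil_itv.
  by move=> [_ /ceil_def ->].
apply: lmeasurable_set_borel.
have mf : measurable_fun setT (fun s : R => ln s / ln 2).
  by apply: measurable_funM => //; exact: measurable_ln.
by apply: mf => //; exact: measurable_itv.
Qed.

End dyadic.

(** * Doubling of the fundamental function *)

Section doubling.
Context {R : realType} (I : set R) (hI : I = `[0, 1]%classic \/ I = `[0, +oo[%classic).
Context (X : fspace R) (hX : quasi_banach_ri I X).

Lemma distr_indic (A : set R) (r : R) : 0 <= r -> A `<=` I ->
  distribution_fun I \1_A r = if r < 1 then lambda R A else 0%E.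
Proof.
move=> r0 AI; rewrite /distribution_fun; case: ifPn => r1.
  congr (lambda R _); apply/seteqP; split => x /=; rewrite indicE normr_nat.
    by case: (boolP (x \in A)); rewrite ?inE//= => _ [_]; rewrite ltNge r0.
  by move=> Ax; split; [exact: AI|rewrite mem_set].
rewrite (_ : mkset _ = set0)// -subset0 => x [_]; rewrite indicE normr_nat.
by case: (x \in A); rewrite /= ?(negPf r1)// ltNge r0.
Qed.

(** Cut [[0, u]] at [s]. The piece []s, u]] is equidistributed with [[0, u - s]], and
    [u - s <= s]. *)
Lemma phi_double (s u : R) :
  (forall f g, X f -> X g -> fnorm X (f \+ g) <= fnorm X f + fnorm X g) ->
  0 < s -> s <= u <= 2 * s -> I u -> phi X u <= 2 * phi X s.
Proof.
move=> tri s0 /andP[su us] Iu.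
have us0 : 0 <= u - s by rewrite subr_ge0.
have X1 : X \1_(`[0, s]%classic) by exact: (ri_itv hI hX).
have X2 : X \1_(`]s, u]%classic) by exact: (ri_itv hI hX).
have X3 : X \1_(`[0, u - s]%classic) by exact: (ri_itv hI hX).
have -> : 2 * phi X s = phi X s + phi X s by ring.
rewrite {1}/phi (_ : \1__ = \1_(`[0, s]%classic) \+ \1_(`]s, u]%classic)); last first.
  apply/funext => x; rewrite /= !indicE !mem_setE !in_itv/=.
  by case: (leP 0 x) => x0; case: (leP x s) => xs; case: (leP x u) => xu //=;
    rewrite ?addr0 ?add0r//; exfalso; lra.
apply: le_trans (tri _ _ X1 X2) _; rewrite lerD2l.
rewrite (ri_equidistr (g := \1_(`[0, u - s]%classic)) hX _ _ _ X2 X3); last first.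
- move=> r r0; rewrite !distr_indic//; last first.
  + move=> x /=; rewrite in_itv/= => /andP[sx xu].
    by apply: I_le Iu => //; rewrite (le_trans (ltW s0))// ltW.
  + move=> x /=; rewrite in_itv/= => /andP[x0 xu].
    by apply: I_le Iu => //; rewrite (le_trans xu)// gerBl ltW.
  case: ifP => // _.
  rewrite [LHS](@lebesgue_measure_itv R `]s, u]) [RHS](@lebesgue_measure_itv R `[0, u - s])/=.
  rewrite !lte_fin subr_gt0; case: ifP => //.
  by rewrite sube0.
- exact: (ri_meas hX X3).
- exact: (ri_meas hX X2).
by apply: (phi_le hI hX); lra.
Qed.

End doubling.

(** * The operator [Q]: measurability, monotonicity and automatic boundedness *)

Section Qop_bounds.
Context {R : realType} (I : set R) (hI : I = `[0, 1]%classic \/ I = `[0, +oo[%classic).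
Context (A0 A1 : fspace R) (hA0 : quasi_banach_ri I A0) (hA1 : quasi_banach_ri I A1).
Context (hinv : A1 (fun t => (phi A1 t)^-1)).
Implicit Types (f g : R -> R).

Lemma Qop_meas f : fsum I A0 (Linfty I) f -> lmeasurable I (Qop A0 A1 f).
Proof.
move=> Sf; apply: lmeasurableM; first exact: (ri_meas hA1).
have Af t := ri_sum_chi hI hA0 t Sf.
(* The norm over [[0, t]] grows with [t]; its negative is nonincreasing, hence measurable. *)
suff mN : lmeasurable I (fun t => - fnorm A0 (f \* \1_(`[0, t]%classic))).
  have := lmeasurableM (lmeasurable_cst (-1)) mN; apply: lmeasurable_ext => x _ /=.
  by rewrite mulN1r opprK.
apply: (lmeasurable_noninc hI) => s t Is It s0 st; rewrite lerN2.
apply: (ri_le hA0 (Af t) _ _).2; first exact: (ri_meas hA0 (Af s)).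
apply: aeonW => x _ /=; rewrite normrM [leRHS]normrM ler_wpM2l//.
rewrite !indicE !normr_nat ler_nat !mem_setE !in_itv/=.
by case: (leP x s) => xs; rewrite ?andbF//= (le_trans xs st).
Qed.

Lemma Qop_ge0 f t : fsum I A0 (Linfty I) f -> 0 <= Qop A0 A1 f t.
Proof.
move=> Sf; apply: mulr_ge0; first by rewrite invr_ge0 (phi_ge0 hI hA1).
exact: (ri_ge0 hA0 (ri_sum_chi hI hA0 t Sf)).
Qed.

Lemma Qop_le f g c t : fsum I A0 (Linfty I) f -> fsum I A0 (Linfty I) g -> 0 <= c ->
  aeon I (fun x => `|f x| <= c * `|g x|) -> Qop A0 A1 f t <= c * Qop A0 A1 g t.
Proof.
move=> Sf Sg c0 fg; rewrite /Qop mulrCA; apply: ler_wpM2l.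
  by rewrite invr_ge0 (phi_ge0 hI hA1).
have [Acg] := ri_scale hA0 c (ri_sum_chi hI hA0 t Sg); rewrite ger0_norm// => <-.
apply: (ri_le hA0 Acg _ _).2; first exact: (ri_meas hA0 (ri_sum_chi hI hA0 t Sf)).
apply: aeon_mp fg => x _ /= fg; rewrite mulrA !normrM ler_wpM2r//.
by rewrite (ger0_norm c0).
Qed.

(* Gliding hump: the sum of normalised counterexamples [f n] would be a single
   element of [X0] whose image under [Qop] has infinite norm. *)
Lemma Q_bounded_of_mem X0 X1 : admissible I A0 A1 (X0, X1) ->
  (forall f, X0 f -> X1 (Qop A0 A1 f)) -> Q_bounded I A0 A1 X0 X1.
Proof.
move=> [/= [hX0 hX1] _ [e0 eX0] _ _] memQ; apply: contrapT => nQ.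
have S f : X0 f -> fsum I A0 (Linfty I) f by move=> /eX0[].
have [c c1 tri] := ri_tri hX0.
have c0 : 0 < c by exact: lt_le_trans c1.
have p0 n : 0 < (2 * c) ^+ n by rewrite exprn_gt0// mulr_gt0.
(* The factor [(2 * c) ^+ n.+1] pays for the weight that [f n] receives in the sum below, and [n%:R]
   makes the lower bounds diverge. *)
have /choice[f hf] : forall n : nat, exists f, X0 f /\
    n%:R * (2 * c) ^+ n.+1 * fnorm X0 f < fnorm X1 (Qop A0 A1 f).
  move=> n; apply: contrapT => nf; apply: nQ.
  exists (n%:R * (2 * c) ^+ n.+1) => f Xf _; split; first exact: memQ.
  by rewrite leNgt; apply/negP => h; apply: nf; exists f.
have Xf n : X0 (f n) by case: (hf n).
(* If [f n] had norm zero, [Q (f n)] would vanish, against the strict inequality. *)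
have f0 n : 0 < fnorm X0 (f n).
  rewrite lt_def (ri_ge0 hX0 (Xf n)) andbT; apply/eqP => fn0.
  have := (hf n).2; rewrite fn0 mulr0.
  have [[[_ Z0 hz _ _] _] _ _ _ _] := hX0.
  have fz : aeon I (fun x => f n x = 0) by apply: (hz _ (Xf n)).1.
  have [[[_ _ hz1 _ _] _] _ _ _ _] := hX1.
  have -> : fnorm X1 (Qop A0 A1 (f n)) = 0; last by rewrite ltxx.
  apply: (hz1 _ (memQ _ (Xf n))).2; apply: aeonW => x _; apply/eqP.
  rewrite eq_le Qop_ge0 ?andbT; last exact: S.
  rewrite -[leRHS](mul0r (Qop A0 A1 (f n) x)); apply: Qop_le => //; [exact: S|exact: S|].
  by apply: aeon_mp fz => y _ ->; rewrite normr0 mul0r.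
(* With this normalisation [g n] has norm [(2 * c) ^- n.+1], so the weights [c ^+ i.+1] of the
   iterated quasi-triangle inequality leave a geometric series of ratio one half. *)
pose a n := (fnorm X0 (f n) * (2 * c) ^+ n.+1)^-1.
have a0 n : 0 < a n by rewrite invr_gt0 mulr_gt0.
pose g n x := a n * `|f n x|.
have hg n : X0 (g n) /\ fnorm X0 (g n) = ((2 * c) ^+ n.+1)^-1.
  have [|Xn nf] := ri_le hX0 (Xf n) (lmeasurable_norm (ri_meas hX0 (Xf n))).
    by apply: aeonW => x _; rewrite normr_id.
  have [|_ fn] := ri_le hX0 Xn (ri_meas hX0 (Xf n)).
    by apply: aeonW => x _; rewrite normr_id.
  have [Xg] := ri_scale hX0 (a n) Xn; split => //.
  rewrite [LHS]b gtr0_norm// (_ : fnorm X0 (fun x => _) = fnorm X0 (f n)); last first.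
    by apply/eqP; rewrite eq_le nf.
  by rewrite /a; field; rewrite !gt_eqF.
have Xg n : X0 (g n) by case: (hg n).
pose F N x := \sum_(i < N) g i x.
have hF N := ri_finite_sum hX0 N tri (ltW c0) Xg.
have XF N : X0 (F N) by case: (hF N).
have g_ge0 n x : 0 <= g n x by rewrite mulr_ge0// ltW.
have F1 N : fnorm X0 (F N) <= 1.
  apply: le_trans (hF N).2 _.
  have -> : \sum_(i < N) c ^+ i.+1 * fnorm X0 (g i) = 1 - 2^-1 ^+ N.
    elim: N => [|N IH]; first by rewrite big_ord0 expr0 subrr.
    rewrite big_ord_recr/= IH (hg N).2 exprMn invfM mulrCA divff ?expf_neq0 ?gt_eqF//.
    by rewrite mulr1 -exprVn exprS; field.
  by rewrite gerBl exprn_ge0// invr_ge0.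
have FS N x : F N.+1 x = F N x + g N x by rewrite /F big_ord_recr.
have F_ge0 N x : 0 <= F N x by apply: sumr_ge0.
have ub : has_ubound (range (fun n => fnorm X0 (F n))).
  by exists 1 => _ [N _ <-].
have [_ _ fatou _ _] := hX0.
have [|[fin XG] _] := fatou F XF _ ub.
  by apply: aeonW => x _ n; rewrite F_ge0 FS lerDl g_ge0.
set G := fine \o _ in XG.
have gG n : aeon I (fun x => `|f n x| <= (a n)^-1 * `|G x|).
  apply: aeon_mp fin => x _ finx; rewrite ler_pdivlMl//.
  apply: le_trans (ler_norm _); rewrite -lee_fin /G/= fineK//.
  apply: (@le_trans _ _ (F n.+1 x)%:E); first by rewrite lee_fin FS lerDr F_ge0.
  by apply: ereal_sup_ubound; exists n.+1.
(* Since [|f n| <= (a n)^-1 * |G|], monotonicity bounds the norm of [Q (f n)] by [(a n)^-1] times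
   that of [Q G], while it exceeds [n%:R * (a n)^-1]. *)
have Qf n : n%:R < fnorm X1 (Qop A0 A1 G).
  have an0 : 0 < (a n)^-1 by rewrite invr_gt0.
  have [XQ] := ri_scale hX1 (a n)^-1 (memQ _ XG); rewrite gtr0_norm// => nQG.
  have [|_] := ri_le hX1 XQ (ri_meas hX1 (memQ _ (Xf n))).
    apply: aeonW => x _ /=.
    have QG0 := Qop_ge0 x (S _ XG); have Qn0 := Qop_ge0 x (S _ (Xf n)).
    rewrite (ger0_norm Qn0) ger0_norm; last exact: mulr_ge0 (ltW an0) QG0.
    by apply: Qop_le; [exact: S|exact: S|exact: ltW|exact: gG].
  rewrite nQG => h; have := lt_le_trans (hf n).2 h.
  have aE : (a n)^-1 = (2 * c) ^+ n.+1 * fnorm X0 (f n) by rewrite /a invrK mulrC.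
  by rewrite -mulrA -aE mulrC ltr_pM2l.
have := Qf (Num.truncn (fnorm X1 (Qop A0 A1 G))).+1.
rewrite ltNge => /negP; apply; apply: ltW; exact: truncnS_gt.
Qed.

End Qop_bounds.

(** * A linear operator that dominates [Q f] for a given [f] *)

Section LI_Q.
Context {R : realType} (I : set R) (hI : I = `[0, 1]%classic \/ I = `[0, +oo[%classic).
Context (A0 A1 : fspace R) (hA0 : quasi_banach_ri I A0) (hA1 : quasi_banach_ri I A1).
Context (tri0 : forall f g, A0 f -> A0 g -> fnorm A0 (f \+ g) <= fnorm A0 f + fnorm A0 g).
Context (hinv : A1 (fun t => (phi A1 t)^-1)).
Context (Cp : R) (Cp0 : 0 < Cp)
  (hphi : forall t, I t -> Cp^-1 * phi A1 t <= phi A0 t <= Cp * phi A1 t).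
Implicit Types (f g : R -> R).

(** The hypothesis [tri0], a triangle inequality with constant 1, makes [fnorm A0] a seminorm on
    [A0], as the Hahn-Banach argument demands. *)
Lemma norming_functional_A0 f : A0 f -> exists L : (R -> R) -> R,
  [/\ forall c f g, A0 f -> A0 g -> L ((c \*o f) \+ g) = c * L f + L g,
      forall f, A0 f -> `|L f| <= fnorm A0 f & L f = fnorm A0 f].
Proof.
move=> Af; have [C _ tri] := ri_tri hA0.
apply: (@norming_functional R (R -> R) A0 (fnorm A0)) => //.
- move=> c g h Ag Ah; apply: (tri _ _ _ Ah).1; exact: (ri_scale hA0 c Ag).1.
- by move=> c g Ag; exact: (ri_scale hA0 c Ag).2.
Qed.

(** The difference has norm zero, so the bound on [L] annihilates it. This makes the operator built
    from such functionals respect equality almost everywhere. *)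
Lemma functional_ae_eq (L : (R -> R) -> R) f g :
  (forall c f g, A0 f -> A0 g -> L ((c \*o f) \+ g) = c * L f + L g) ->
  (forall f, A0 f -> `|L f| <= fnorm A0 f) ->
  A0 f -> A0 g -> aeon I (fun x => f x = g x) -> L f = L g.
Proof.
move=> Llin Lb Af Ag fg; have [C _ tri] := ri_tri hA0.
have Ad : A0 ((-1 \*o f) \+ g) by apply: (tri _ _ _ Ag).1; exact: (ri_scale hA0 (-1) Af).1.
have := Lb _ Ad; rewrite Llin//.
have -> : fnorm A0 ((-1 \*o f) \+ g) = 0.
  have [[[_ _ hz _ _] _] _ _ _ _] := hA0.
  by apply: (hz _ Ad).2; apply: aeon_mp fg => x _ /= ->; rewrite mulN1r addNr.
by rewrite normr_le0 mulN1r addrC subr_eq0 => /eqP.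
Qed.

Lemma dyadic_up_I s : I s -> I (dyadic_up s).
Proof.
have u0 := ltW (dyadic_up_gt0 s).
case: hI => -> /=; rewrite !in_itv/= u0//= => /andP[_ s1].
exact: dyadic_up_le1.
Qed.

(** [A1] is only quasi-normed, so the doubling is taken from [phi A0], at the price of one factor
    [Cp] in each direction. *)
Lemma phi1_double s : I s -> 0 < s -> phi A1 (dyadic_up s) <= 2 * Cp ^+ 2 * phi A1 s.
Proof.
move=> Is s0; have Iu := dyadic_up_I Is.
have := hphi Is => /andP[_ h1]; have := hphi Iu => /andP[+ _].
rewrite ler_pdivrMl// => /le_trans; apply.
have := phi_double hI hA0 tri0 s0 (dyadic_up_bounds s0) Iu => h2.
apply: (@le_trans _ _ (Cp * (2 * (Cp * phi A1 s)))); last first.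
  by rewrite le_eqVlt; apply/orP; left; apply/eqP; ring.
rewrite ler_pM2l//; apply: le_trans h2 _; rewrite ler_pM2l//.
Qed.

Lemma LI_Qop_mem X0 X1 f : LI I A0 A1 (X0, X1) -> X0 f -> X1 (Qop A0 A1 f).
Proof.
move=> [[/= [hX0 hX1] _ [e0 eX0] _ _] hT] Xf.
have Sf : fsum I A0 (Linfty I) f by case: (eX0 _ Xf).
pose r (t : R) : (R -> R) -> (R -> R) := fun g => g \* \1_(`[0, t]%classic).
have Ar t g : fsum I A0 (Linfty I) g -> A0 (r t g) by exact: (ri_sum_chi hI hA0 t).
(* One functional for each scale [t], norming this fixed [f] cut off to [[0, t]]. The choice depends
   on [f] but not on the argument of [T], hence [T] is linear. *)
have /choice[L hL] : forall t, exists L : (R -> R) -> R,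
  [/\ forall c g h, A0 g -> A0 h -> L ((c \*o g) \+ h) = c * L g + L h,
      forall g, A0 g -> `|L g| <= fnorm A0 g & L (r t f) = fnorm A0 (r t f)].
  by move=> t; apply: norming_functional_A0; exact: Ar.
have Llin t : forall c g h, A0 g -> A0 h -> L t ((c \*o g) \+ h) = c * L t g + L t h.
  by case: (hL t).
have Lb t : forall g, A0 g -> `|L t g| <= fnorm A0 g by case: (hL t).
pose T g s := (phi A1 (dyadic_up s))^-1 * L (dyadic_up s) (r (dyadic_up s) g).
have mT g : lmeasurable I (T g).
  pose h (k : int) := (phi A1 (expR (ln 2 * k%:~R)))^-1 *
    L (expR (ln 2 * k%:~R)) (r (expR (ln 2 * k%:~R)) g).
  exact: (lmeasurable_dyadic h (I_meas hI)).
have p0 s : 0 < phi A1 (dyadic_up s) by apply: (phi_gt0 hI hA1); exact: dyadic_up_gt0.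
have Tb g s : fsum I A0 (Linfty I) g ->
    `|T g s| <= (phi A1 (dyadic_up s))^-1 * fnorm A0 (r (dyadic_up s) g).
  move=> Sg; rewrite normrM gtr0_norm ?invr_gt0// ler_pM2l ?invr_gt0//.
  by apply: Lb; exact: Ar.
have SA g : A0 g -> fsum I A0 (Linfty I) g by exact: fsum_l.
have SL g : Linfty I g -> fsum I A0 (Linfty I) g by exact: fsum_r.
(* Pointwise [|T g|] is at most the norm of [g] times [1 / phi A1], and the latter belongs to
   [A1]. *)
have TA g : A0 g -> A1 (T g) /\
    fnorm A1 (T g) <= fnorm A1 (fun t => (phi A1 t)^-1) * fnorm A0 g.
  move=> Ag; have g0 := ri_ge0 hA0 Ag.
  have [Ai] := ri_scale hA1 (fnorm A0 g) hinv; rewrite (ger0_norm g0) mulrC => <-.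
  apply: (ri_le hA1 Ai (mT g)); apply: (aeon_pos hI) => s Is s0 /=.
  have ps := phi_gt0 hI hA1 s0.
  apply: le_trans (Tb _ _ (SA _ Ag)) _.
  rewrite ger0_norm ?mulr_ge0 ?invr_ge0 ?(ltW ps)// mulrC.
  apply: ler_pM; rewrite ?invr_ge0 ?(ltW (p0 _))//.
  - by apply: (ri_ge0 hA0); exact: Ar (SA _ Ag).
  - by have [] := ri_chi hA0 (dyadic_up s) Ag.
  - by rewrite lef_pV2 ?posrE//; apply: (phi_le hI hA1); case/andP: (dyadic_up_bounds s0).
(* Over [[0, u]] the norm of [g] in [A0] is at most its sup norm times [phi A0 u], and dividing by
   [phi A1 u] leaves at most [Cp]. *)
have TL g : Linfty I g -> Linfty I (T g) /\ fnorm (Linfty I) (T g) <= Cp * fnorm (Linfty I) g.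
  move=> Lg; have [g0 gb] := Linfty_le Lg.
  apply: Linfty_of_le => //; first by rewrite mulr_ge0// ltW.
  apply: aeonW => s Is; apply: le_trans (Tb _ _ (SL _ Lg)) _.
  rewrite ler_pdivrMl//.
  have [_ h] := ri_bounded_chi hI hA0 (dyadic_up s) (proj1 Lg) g0 gb.
  apply: le_trans h _.
  have /andP[_ h2] := hphi (dyadic_up_I Is).
  rewrite [leRHS](_ : _ = fnorm (Linfty I) g * (Cp * phi A1 (dyadic_up s))); last by ring.
  exact: ler_wpM2l.
have Tae g h s : fsum I A0 (Linfty I) g -> fsum I A0 (Linfty I) h ->
    aeon I (fun x => g x = h x) -> T g s = T h s.
  move=> Sg Sh gh; congr (_ * _).
  apply: functional_ae_eq (Llin _) (Lb _) (Ar _ _ Sg) (Ar _ _ Sh) _.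
  by apply: aeon_mp gh => x _ e; rewrite /r/= e.
have Tlin c g h s : fsum I A0 (Linfty I) g -> fsum I A0 (Linfty I) h ->
    T ((c \*o g) \+ h) s = c * T g s + T h s.
  move=> Sg Sh; rewrite /T; set u := dyadic_up s.
  rewrite (_ : r u _ = (c \*o r u g) \+ r u h); last first.
    by apply/funext => x; rewrite /r/= mulrDl mulrA.
  by rewrite Llin; [ring|exact: Ar|exact: Ar].
have linT : linear_op I (fsum I A0 (Linfty I)) (fsum I A1 (Linfty I)) T.
  split.
  - move=> g [mg [a [b [Aa Lgb gab]]]]; split => //; exists (T a), (T b); split.
    + by case: (TA _ Aa).
    + by case: (TL _ Lgb).
    + apply: aeonW => s _; rewrite -[T a s]mul1r -Tlin; [|exact: SA|exact: SL].
      have Sg : fsum I A0 (Linfty I) g by split => //; exists a, b.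
      apply: Tae => //.
        split.
          apply: lmeasurableD; last by case: Lgb.
          by apply: lmeasurableM; [exact: lmeasurable_cst|exact: (ri_meas hA0)].
        by exists a, b; split => //; apply: aeonW => x _ /=; rewrite mul1r.
      by apply: aeon_mp gab => x _ /= ->; rewrite mul1r.
  - by move=> g h Sg Sh gh; apply: aeonW => s _; exact: Tae.
  - by move=> c g h Sg Sh; apply: aeonW => s _; exact: Tlin.
have [C hC] : bounded_op X0 X1 T.
  by apply: hT => //; [eexists; exact: TA|eexists; exact: TL].
have [XT _] := hC _ Xf.
(* The factor [2 * Cp ^+ 2] is the cost, by [phi1_double], of replacing [phi A1 s] by
   [phi A1 (dyadic_up s)] in the denominator. *)
have [XcT _] := ri_scale hX1 (2 * Cp ^+ 2) XT.
apply: (ri_le hX1 XcT _ _).1; first exact: (Qop_meas hI hA0 hA1 hinv Sf).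
apply: (aeon_pos hI) => s Is s0 /=.
have ps := phi_gt0 hI hA1 s0.
rewrite (ger0_norm (Qop_ge0 hI hA0 hA1 s Sf)); apply: le_trans (ler_norm _).
(* At [f] itself each functional attains the norm, which turns the linear [T] into [Q f] sampled at
   dyadic scales. *)
have -> : T f s = (phi A1 (dyadic_up s))^-1 * fnorm A0 (r (dyadic_up s) f).
  by rewrite /T; case: (hL (dyadic_up s)) => _ _ ->.
rewrite /Qop ler_pdivrMl// !mulrA.
have fr : fnorm A0 (r s f) <= fnorm A0 (r (dyadic_up s) f).
  apply: (ri_le hA0 (Ar _ _ Sf) _ _).2; first exact: ri_meas (Ar s f Sf).
  apply: aeonW => x _ /=; rewrite normrM [leRHS]normrM ler_wpM2l//.
  rewrite !indicE !normr_nat ler_nat !mem_setE !in_itv/=.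
  case: (leP x s) => xs; rewrite ?andbF//= (le_trans xs)//.
  by case/andP: (dyadic_up_bounds s0).
apply: le_trans fr _; apply: ler_peMl; first by apply: (ri_ge0 hA0); exact: Ar.
rewrite ler_pdivlMr// mul1r; apply: le_trans (phi1_double Is s0) _.
by rewrite le_eqVlt; apply/orP; left; apply/eqP; ring.
Qed.

End LI_Q.

Theorem theorem1 (R : realType) (I : set R)
    (hI : I = `[0, 1]%classic \/ I = `[0, +oo[%classic)
    (A0 A1 : fspace R)
    (hA0 : banach_ri I A0) (hA1 : quasi_banach_ri I A1)
    (hphi : exists2 C : R, 0 < C &
       forall t, I t -> C^-1 * phi A1 t <= phi A0 t <= C * phi A1 t)
    (hinv : A1 (fun t => (phi A1 t)^-1)) :
  LI I A0 A1 = Mclass I A0 A1 /\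
  (forall X0 X1 : fspace R, admissible I A0 A1 (X0, X1) ->
     (LI I A0 A1 (X0, X1) <-> Q_bounded I A0 A1 X0 X1)).
Proof.
have [qA0 tri0 _] := hA0; have [C C0 phiC] := hphi.
have LIQ X0 X1 : LI I A0 A1 (X0, X1) -> Q_bounded I A0 A1 X0 X1.
  move=> hLI; apply: (Q_bounded_of_mem hI qA0 hA1); first by case: hLI.
  by move=> f; apply: (LI_Qop_mem hI qA0 hA1 tri0 hinv C0 phiC hLI).
have QM X0 X1 := @Q_bounded_Mclass R I hI A0 A1 hA1 X0 X1.
have MLI X0 X1 : Mclass I A0 A1 (X0, X1) -> LI I A0 A1 (X0, X1).
  exact: (Mclass_LI hI qA0 hA1 C0 phiC).
split.
  apply/seteqP; split=> -[X0 X1]; last exact: MLI.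
  by move=> hLI; apply: QM; [case: hLI|exact: LIQ].
move=> X0 X1 adm; split; first exact: LIQ.
by move=> hQ; apply: MLI; exact: QM.
Qed.
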